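(* Let $\mathcal A$ be a category with an exact class $\Delta$ of sequences (with trivial morphism class $S$) and a $\Delta$-stability structure $\preceq$, such that $\mathrm{Hom}(A,B)=0_c=S$ for all $\Delta$-semistable objects $A\succ B$. If $\mathcal A$ is weakly $\Delta$-Artinian and weakly $\Delta$-Noetherian, then for every object $E\in\mathcal A$ there exists a Harder-Narasimhan sequence, unique up to isomorphism, $$E_0\xrightarrow{i_0}E_1\xrightarrow{i_1}\cdots\xrightarrow{i_{n-1}}E_n=E$$ such that, setting $F_0:=E_0$, one has $E_{j-1}\xrightarrow{i_{j-1}}E_j\to F_j\in\Delta$ for $1\le j\le n$, and $F_0,\dots,F_n$ are $\Delta$-semistable objects of $\mathcal A$ with $$F_0\succ F_1\succ\cdots\succ F_n.$$
   Context: **Exact class.** Let $\mathcal A$ be a category with a specified class $S$ of (trivial) morphisms; write $f=S$ for $f\in S$, and $\mathrm{Hom}(A,B)=S$ if every morphism $A\to B$ is in $S$. The symbol $0_c$ denotes a trivial morphism class with $f\circ 0_c=0_c\circ f=0_c$ whenever defined. A class $\Delta$ of sequences $E'\xrightarrow{i}E\xrightarrow{p}F$ in $\mathcal A$ is exact if in each such sequence $i,p$ are not in $S$ and are not isomorphisms, and: (1) for any $F_1\to E_1\xrightarrow{p_1}E_2$ and $F_2\to E_2\xrightarrow{p_2}E_3$ in $\Delta$ there exist sequences $F_1'\to E_1\xrightarrow{p_2\circ p_1}E_3$ and $F_1\to F_1'\to F_2$ in $\Delta$; (2) for any $E_1\xrightarrow{i_1}E_2\to F_1$ and $E_2\xrightarrow{i_2}E_3\to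 F_2$ in $\Delta$ there exist sequences $E_1\xrightarrow{i_2\circ i_1}E_3\to F_1'$ and $F_1\to F_1'\to F_2$ in $\Delta$; (3) for any $E_1\xrightarrow{i}E_2\xrightarrow{p}F_1$ in $\Delta$ and morphisms $f:E_2\to E_2'$, $p':E_2'\to F_1'$ with $p'\circ f\circ i=S$, there is $g^1:F_1\to F_1'$ with $g^1\circ p=p'\circ f$; similarly, if $p\circ f'\circ i'=S$ for $f':E_2'\to E_2$, $i':E_1'\to E_2'$, there is $g^0:E_1'\to E_1$ with $i\circ g^0=f'\circ i'$; (4) given a commutative diagram $(g^0,f,g^1)$ between sequences $E_1\xrightarrow{i}E_2\xrightarrow{p}F_1$ and $E_1'\xrightarrow{i'}E_2'\xrightarrow{p'}F_1'$ of $\Delta$, if two of $g^0,f,g^1$ are isomorphisms, so is the third; moreover if $f$ is an identity, $p'=p$ and $i'=i$, then $g^0,g^1$ are identities. **$\Delta$-stability structure.** Assuming each sequence in $\Delta$ is unique up to isomorphism, a $\Delta$-stability structure is a partial order (preorder) $\preceq$ on the objects of $\mathcal A$ such that for every sequence $A\to B\to C$ in $\Delta$ one of the following holds ($\Delta$-seesaw property): (i) $A\prec B\Leftrightarrow A\prec C\Leftrightarrow B\prec C$; (ii) $A\succ B\Leftrightarrow A\succ C\Leftrightarrow B\succ C$; (iii) $A\asymp B\Leftrightarrow A\asymp C\Leftrightarrow B\asymp C$. An object $A$ is $\Delta$-semistable if $B\preceq A$ for every sequence $B\to A\to C$ in $\Delta$ (in particular if there is no such sequence). **Chain conditions.** Weakly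 $\Delta$-Artinian: there is no infinite chain $\cdots\xrightarrow{i_3}E_2\xrightarrow{i_2}E_1\xrightarrow{i_1}E_0=E$ with $E\prec E_1\prec E_2\prec\cdots$ and $E_j\xrightarrow{i_j}E_{j-1}\to F_j\in\Delta$ for all $j>0$. Weakly $\Delta$-Noetherian: there is no infinite chain $E=E_0\xrightarrow{p_1}E_1\xrightarrow{p_2}E_2\xrightarrow{p_3}\cdots$ with $E\succ E_1\succ E_2\succ\cdots$ and $F_j\to E_{j-1}\xrightarrow{p_j}E_j\in\Delta$ for all $j>0$.
   Formalization: Uniqueness is stated only when any two objects are comparable under ⪯ (total preorder), as it fails for some partial preorders; existence holds for every preorder. The seesaw property is read as: in one of its three cases, all three relations hold. *)

(* Defs.v *)
From Stdlib Require Import Relations.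
From mathcomp Require Import all_boot.

Set Implicit Arguments.
Unset Strict Implicit.
Unset Printing Implicit Defensive.

Record category : Type := Category {
  Ob :> Type;
  Hom : Ob -> Ob -> Type;
  idm : forall A, Hom A A;
  compm : forall A B C, Hom B C -> Hom A B -> Hom A C;
  compm_idl : forall A B (f : Hom A B), compm (idm B) f = f;
  compm_idr : forall A B (f : Hom A B), compm f (idm A) = f;
  compm_assoc : forall A B C D (h : Hom C D) (g : Hom B C) (f : Hom A B),
    compm h (compm g f) = compm (compm h g) f
}.

Arguments Hom {c} A B.
Arguments idm {c} A.
Arguments compm {c A B C} g f.

Declare Scope category_scope.
Delimit Scope category_scope with category.
Notation "g \oc f" := (compm g f)
  (at level 40, left associativity) : category_scope.
Open Scope category_scope.

Definition is_iso (C : category) (A B : C) (f : Hom A B) : Prop :=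
  exists g : Hom B A, g \oc f = idm A /\ f \oc g = idm B.

Definition morphism_class (C : category) : Type :=
  forall A B : C, Hom A B -> Prop.

(* A class of composable pairs [A --i--> B --p--> F]. *)
Definition sequence_class (C : category) : Type :=
  forall A B F : C, Hom A B -> Hom B F -> Prop.

(* [Hom(A, B) = S] *)
Definition hom_eq (C : category) (S : morphism_class C) (A B : C) : Prop :=
  forall f : Hom A B, S A B f.

(* [S] can serve as [0_c], i.e. [f o S = S o f = S]. *)
Definition zero_class (C : category) (S : morphism_class C) : Prop :=
  (forall (A B D : C) (s : Hom A B) (f : Hom B D), S A B s -> S A D (f \oc s)) /\
  (forall (A B D : C) (f : Hom A B) (s : Hom B D), S B D s -> S A D (s \oc f)).

Section Delta.

Variables (C : category) (S : morphism_class C) (Delta : sequence_class C).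

(* In [exact_quot] and [exact_sub] the two new sequences are not required to be
   compatible with the given ones, and [p o i] in [S] is not an axiom. *)
Record exact_class : Prop := ExactClass {
  exact_proper : forall (A B F : C) (i : Hom A B) (p : Hom B F),
    Delta i p ->
    [/\ ~ S i, ~ S p, ~ is_iso i & ~ is_iso p];
  exact_quot : forall (E1 E2 E3 F1 F2 : C)
      (i1 : Hom F1 E1) (p1 : Hom E1 E2) (i2 : Hom F2 E2) (p2 : Hom E2 E3),
    Delta i1 p1 -> Delta i2 p2 ->
    exists F1' : C,
      (exists i : Hom F1' E1, Delta i (p2 \oc p1)) /\
      (exists (j : Hom F1 F1') (q : Hom F1' F2), Delta j q);
  exact_sub : forall (E1 E2 E3 F1 F2 : C)
      (i1 : Hom E1 E2) (p1 : Hom E2 F1) (i2 : Hom E2 E3) (p2 : Hom E3 F2),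
    Delta i1 p1 -> Delta i2 p2 ->
    exists F1' : C,
      (exists p : Hom E3 F1', Delta (i2 \oc i1) p) /\
      (exists (j : Hom F1 F1') (q : Hom F1' F2), Delta j q);
  exact_factor_quot : forall (E1 E2 F1 : C) (i : Hom E1 E2) (p : Hom E2 F1)
      (E2' F1' : C) (f : Hom E2 E2') (p' : Hom E2' F1'),
    Delta i p -> S (p' \oc f \oc i) ->
    exists g1 : Hom F1 F1', g1 \oc p = p' \oc f;
  exact_factor_sub : forall (E1 E2 F1 : C) (i : Hom E1 E2) (p : Hom E2 F1)
      (E1' E2' : C) (f' : Hom E2' E2) (i' : Hom E1' E2'),
    Delta i p -> S (p \oc f' \oc i') ->
    exists g0 : Hom E1' E1, i \oc g0 = f' \oc i';
  exact_two_of_three : forall (E1 E2 F1 E1' E2' F1' : C)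
      (i : Hom E1 E2) (p : Hom E2 F1) (i' : Hom E1' E2') (p' : Hom E2' F1')
      (g0 : Hom E1 E1') (f : Hom E2 E2') (g1 : Hom F1 F1'),
    Delta i p -> Delta i' p' -> f \oc i = i' \oc g0 -> g1 \oc p = p' \oc f ->
    (is_iso g0 -> is_iso f -> is_iso g1) /\
    (is_iso g0 -> is_iso g1 -> is_iso f) /\
    (is_iso f -> is_iso g1 -> is_iso g0);
  exact_identity : forall (E1 E2 F1 : C) (i : Hom E1 E2) (p : Hom E2 F1)
      (g0 : Hom E1 E1) (g1 : Hom F1 F1),
    Delta i p -> idm E2 \oc i = i \oc g0 -> g1 \oc p = p \oc idm E2 ->
    g0 = idm E1 /\ g1 = idm F1
}.

(* Each of the two morphisms of a sequence determines the other one up to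
   isomorphism. *)
Definition sequences_unique : Prop :=
  (forall (A B F F' : C) (i : Hom A B) (p : Hom B F) (p' : Hom B F'),
     Delta i p -> Delta i p' ->
     exists g : Hom F F', is_iso g /\ g \oc p = p') /\
  (forall (A A' B F : C) (i : Hom A B) (i' : Hom A' B) (p : Hom B F),
     Delta i p -> Delta i' p ->
     exists g : Hom A A', is_iso g /\ i' \oc g = i).

Variable le : relation C.

Definition strictly_below (A B : C) : Prop := le A B /\ ~ le B A.
Definition order_equiv (A B : C) : Prop := le A B /\ le B A.

(* In each alternative of the seesaw property the three equivalent relations
   hold.  Read as mere equivalences, the alternatives would be satisfied as soon
   as the three relations of one of them fail, and would constrain almost
   nothing. *)
Definition seesaw : Prop :=
  forall (A B F : C) (i : Hom A B) (p : Hom B F), Delta i p ->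
    [\/ [/\ strictly_below A B, strictly_below A F & strictly_below B F],
        [/\ strictly_below B A, strictly_below F A & strictly_below F B] |
        [/\ order_equiv A B, order_equiv A F & order_equiv B F]].

Record stability_structure : Prop := StabilityStructure {
  stability_preorder : preorder C le;
  stability_seesaw : seesaw
}.

(* Comparability is not part of [preorder].  Without it a Harder-Narasimhan
   sequence still exists, but it need not be unique. *)
Definition comparable_objects : Prop := forall A B : C, le A B \/ le B A.

Definition semistable (A : C) : Prop :=
  forall (B F : C) (i : Hom B A) (p : Hom A F), Delta i p -> le B A.

Definition weakly_Artinian : Prop :=
  ~ exists (E F : nat -> C) (i : forall j, Hom (E j.+1) (E j))
           (p : forall j, Hom (E j) (F j)),
      forall j, strictly_below (E j) (E j.+1) /\ Delta (i j) (p j).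

Definition weakly_Noetherian : Prop :=
  ~ exists (E F : nat -> C) (i : forall j, Hom (F j) (E j))
           (p : forall j, Hom (E j) (E j.+1)),
      forall j, strictly_below (E j.+1) (E j) /\ Delta (i j) (p j).

(* [filtration E] is the type of diagrams [E_0 -> E_1 -> ... -> E_n = E], n >= 0,
   with a morphism [E_j -> F_j] for each [1 <= j <= n].  [FiltBase] is the case
   [n = 0]; [FiltStep] adds [E_n] and [F_n] to a diagram ending in [E_{n-1}]. *)
Inductive filtration : C -> Type :=
| FiltBase (E : C) : filtration E
| FiltStep (E' E F : C) (i : Hom E' E) (p : Hom E F) :
    filtration E' -> filtration E.

(* [F_n], where [F_0 = E_0]. *)
Definition last_factor (E : C) (x : filtration E) : C :=
  match x with
  | FiltBase E0 => E0
  | @FiltStep _ _ F _ _ _ => F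
  end.

Fixpoint Harder_Narasimhan (E : C) (x : filtration E) : Prop :=
  match x with
  | FiltBase E0 => semistable E0
  | @FiltStep _ _ F i p x' =>
      [/\ Harder_Narasimhan x', Delta i p, semistable F
        & strictly_below F (last_factor x')]
  end.

(* [filtration_iso phi x y]: [x] and [y] have the same length and there are
   isomorphisms [E_j -> E_j'] and [F_j -> F_j'] commuting with all the morphisms
   of the two diagrams, the one between the last terms being [phi]. *)
Inductive filtration_iso :
  forall E1 E2 : C, Hom E1 E2 -> filtration E1 -> filtration E2 -> Prop :=
| FiltIsoBase (E1 E2 : C) (phi : Hom E1 E2) :
    is_iso phi -> filtration_iso phi (FiltBase E1) (FiltBase E2)
| FiltIsoStep (E1' E1 F1 E2' E2 F2 : C)
    (i1 : Hom E1' E1) (p1 : Hom E1 F1) (x1 : filtration E1')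
    (i2 : Hom E2' E2) (p2 : Hom E2 F2) (x2 : filtration E2')
    (phi' : Hom E1' E2') (phi : Hom E1 E2) (psi : Hom F1 F2) :
    filtration_iso phi' x1 x2 -> is_iso phi -> is_iso psi ->
    phi \oc i1 = i2 \oc phi' -> psi \oc p1 = p2 \oc phi ->
    filtration_iso phi (FiltStep i1 p1 x1) (FiltStep i2 p2 x2).

End Delta.

(* Main.v *)
(**
Existence follows Bridgeland's argument for abelian categories.  By the Artinian
condition an object [E] that is not semistable has a semistable subobject
[A > E]; a morphism from [E] to a semistable object strictly below [E/A] kills
[A], hence factors through [E/A], so Noetherian induction yields a semistable
quotient [E -> B] such that [E] has only trivial morphisms to the semistable
objects strictly below [B].  By Artinian induction the kernel [E'] of [E -> B]
has a Harder-Narasimhan sequence; let [G] be its last factor.  Either [G > B],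
and [B] is appended, or [G] is equivalent to [B], and the extension of [B] by
[G] is semistable and replaces both.

For uniqueness, an object all of whose factors are strictly above a semistable
object [B] has only trivial morphisms to [B].  This forces the last factors of
two Harder-Narasimhan sequences to be equivalent, then the isomorphism of the
last terms to restrict to the preceding ones.
*)

Require Import Defs.
From Stdlib Require Import Relations Classical ClassicalEpsilon.
From mathcomp Require Import all_boot.

Set Implicit Arguments.
Unset Strict Implicit.
Unset Printing Implicit Defensive.

(** Otherwise every counterexample to [P] has an [R]-successor that is one too, and choice strings
    these into an infinite chain. *)
Lemma no_infinite_chain_ind (T : Type) (R : T -> T -> Prop) :
  ~ (exists e : nat -> T, forall j, R (e j) (e j.+1)) ->
  forall P : T -> Prop,
    (forall x, (forall y, R x y -> P y) -> P x) -> forall x, P x.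
Proof.
move=> no_chain P IH x; apply: NNPP => nPx; apply: no_chain.
have next (z : {x | ~ P x}) : exists y : {x | ~ P x}, R (sval z) (sval y).
  case: z => z nPz /=; apply: NNPP => no_next; apply/nPz/IH => y Rzy.
  by apply: NNPP => nPy; apply: no_next; exists (exist _ y nPy).
pose step z := sval (constructive_indefinite_description _ (next z)).
exists (fun j => sval (iter j step (exist _ x nPx))) => j /=.
by rewrite /step; case: constructive_indefinite_description.
Qed.

Section HarderNarasimhan.

Variables (C : category) (S : morphism_class C) (Delta : sequence_class C).
Variable (le : relation C).
Arguments S {A B}.
Arguments Delta {A B F}.

Local Notation lt := (strictly_below le).
Local Notation semistable := (semistable (@Delta) le).

Hypothesis Delta_exact : exact_class (@S) (@Delta).
Hypothesis le_stability : stability_structure (@Delta) le.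
Hypothesis S_zero : zero_class (@S).
Hypothesis hom_semistable : forall A B : C,
  semistable A -> semistable B -> lt B A -> hom_eq (@S) A B.

(** * Order, trivial morphisms and factorizations along one sequence of [Delta] *)

Lemma le_trans (A B D : C) : le A B -> le B D -> le A D.
Proof. exact: (preord_trans _ _ (stability_preorder le_stability)). Qed.

Lemma lt_le_trans (A B D : C) : lt A B -> le B D -> lt A D.
Proof.
move=> [AB nBA] BD; split; first exact: le_trans BD.
by move=> DA; apply: nBA; apply: le_trans DA.
Qed.

Lemma le_lt_trans (A B D : C) : le A B -> lt B D -> lt A D.
Proof.
move=> AB [BD nDB]; split; first exact: le_trans BD.
by move=> DA; apply: nDB; apply: le_trans AB.
Qed.

Lemma lt_trans (A B D : C) : lt A B -> lt B D -> lt A D.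
Proof. by move=> [AB _]; apply: le_lt_trans. Qed.

Lemma S_compl (A B D : C) (s : Hom A B) (f : Hom B D) : S s -> S (f \oc s).
Proof. exact: (proj1 S_zero). Qed.

Lemma S_compr (A B D : C) (f : Hom A B) (s : Hom B D) : S s -> S (s \oc f).
Proof. exact: (proj2 S_zero). Qed.

Lemma Delta_nzl (A B F : C) (i : Hom A B) (p : Hom B F) : Delta i p -> ~ S i.
Proof. by case/(exact_proper Delta_exact). Qed.

Lemma Delta_nzr (A B F : C) (i : Hom A B) (p : Hom B F) : Delta i p -> ~ S p.
Proof. by case/(exact_proper Delta_exact). Qed.

Lemma factor_through_quotient (A B F D : C) (i : Hom A B) (p : Hom B F)
    (h : Hom B D) :
  Delta i p -> S (h \oc i) -> exists g : Hom F D, g \oc p = h.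
Proof.
move=> d s; have := @exact_factor_quot _ _ _ Delta_exact _ _ _ _ _ _ _ h (idm D) d.
by rewrite !compm_idl; apply.
Qed.

Lemma factor_through_sub (A B F D : C) (i : Hom A B) (p : Hom B F)
    (h : Hom D B) :
  Delta i p -> S (p \oc h) -> exists g : Hom D A, i \oc g = h.
Proof.
move=> d s; have := @exact_factor_sub _ _ _ Delta_exact _ _ _ _ _ _ _ h (idm D) d.
by rewrite !compm_idr; apply.
Qed.

Lemma hom_eq_extension (A B F D : C) (i : Hom A B) (p : Hom B F) :
  Delta i p -> hom_eq (@S) A D -> hom_eq (@S) F D -> hom_eq (@S) B D.
Proof.
move=> d sA sF h; have [g <-] := factor_through_quotient d (sA (h \oc i)).
exact/S_compr/sF.
Qed.

(** The factors increase towards [F_0], so [B] stays strictly below each of them along the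
    induction. *)
Lemma hom_eq_HN (E B : C) (x : filtration E) :
  Harder_Narasimhan (@Delta) le x -> semistable B -> lt B (last_factor x) ->
  hom_eq (@S) E B.
Proof.
elim: x => [E0 ssE | E' E0 F i p x IHx [/IHx hnx d ssF ltF]] ssB ltB.
  exact: hom_semistable.
apply: hom_eq_extension d _ _; last exact: hom_semistable.
exact: hnx ssB (lt_trans ltB ltF).
Qed.

Lemma lt_quotient_sub (A B F : C) (i : Hom A B) (p : Hom B F) :
  Delta i p -> lt F B -> lt B A.
Proof.
by move=> d [_ nBF]; case: (stability_seesaw le_stability d) => -[] // _ _ [].
Qed.

(** Failure of [le A E] leaves only the second seesaw alternative. *)
Lemma not_semistable_sub (E : C) : ~ semistable E ->
  exists A F (i : Hom A E) (p : Hom E F), [/\ Delta i p, lt E A & lt F E].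
Proof.
move=> nss; apply: NNPP => no; apply: nss => A F i p d.
have [[[//]]|[ltEA _ ltFE]|[[//]]] := stability_seesaw le_stability d.
by case: no; exists A, F, i, p.
Qed.

(** * Existence, by induction along destabilizing chains *)

Section Existence.

Hypothesis artinian : weakly_Artinian (@Delta) le.
Hypothesis noetherian : weakly_Noetherian (@Delta) le.

Lemma Artinian_ind (P : C -> Prop) :
  (forall E, (forall E' F (i : Hom E' E) (p : Hom E F),
     Delta i p -> lt E E' -> P E') -> P E) ->
  forall E, P E.
Proof.
(* The sequence is a witness inside the relation, so that choice can recover the morphisms of the
   chain. *)
move=> IH; apply: (@no_infinite_chain_ind _ (fun E E' => exists w :
    {F : C & (Hom E' E * Hom E F)%type},
    lt E E' /\ Delta (projT2 w).1 (projT2 w).2)).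
  case=> e chain; apply: artinian.
  pose w j := constructive_indefinite_description _ (chain j).
  exists e, (fun j => projT1 (sval (w j))), (fun j => (projT2 (sval (w j))).1),
    (fun j => (projT2 (sval (w j))).2) => j.
  exact: (svalP (w j)).
move=> E IHE; apply: IH => E' F i p d ltE.
by apply: IHE; exists (existT _ F (i, p)).
Qed.

Lemma Noetherian_ind (P : C -> Prop) :
  (forall E, (forall F E' (i : Hom F E) (p : Hom E E'),
     Delta i p -> lt E' E -> P E') -> P E) ->
  forall E, P E.
Proof.
move=> IH; apply: (@no_infinite_chain_ind _ (fun E E' => exists w :
    {F : C & (Hom F E * Hom E E')%type},
    lt E' E /\ Delta (projT2 w).1 (projT2 w).2)).
  case=> e chain; apply: noetherian.
  pose w j := constructive_indefinite_description _ (chain j).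
  exists e, (fun j => projT1 (sval (w j))), (fun j => (projT2 (sval (w j))).1),
    (fun j => (projT2 (sval (w j))).2) => j.
  exact: (svalP (w j)).
move=> E IHE; apply: IH => F E' i p d ltE.
by apply: IHE; exists (existT _ F (i, p)).
Qed.

(** If the destabilizing [B] is not semistable, induction gives [A] inside [B], and [exact_sub]
    makes [A] a subobject of [E]. *)
Lemma destabilizing_semistable_sub (E : C) : ~ semistable E ->
  exists A F (i : Hom A E) (p : Hom E F),
    [/\ Delta i p, semistable A, lt E A & lt F E].
Proof.
elim/Artinian_ind: E => E IH /not_semistable_sub[B [F [i [p [d ltEB ltFE]]]]].
have [ssB | nssB] := classic (semistable B); first by exists B, F, i, p.
have [A [F2 [i2 [p2 [d2 ssA ltBA _]]]]] := IH _ _ _ _ d ltEB nssB.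
have [F' [[p' d'] _]] := exact_sub Delta_exact d2 d.
have ltEA := lt_trans ltEB ltBA.
exists A, F', (i \oc i2), p'; split=> //.
by case: (stability_seesaw le_stability d') => -[] [] // ? ?; case: ltEA.
Qed.

(** Stated for all morphisms rather than for quotients, so that [hom_eq_extension] carries it from a
    quotient of [E] to [E]. *)
Definition minimal_quotient (E B : C) : Prop :=
  forall D, semistable D -> lt D B -> hom_eq (@S) E D.

Lemma minimal_semistable_quotient (E : C) : ~ semistable E ->
  exists E' B (i : Hom E' E) (p : Hom E B),
    [/\ Delta i p, semistable B, lt B E & minimal_quotient E B].
Proof.
elim/Noetherian_ind: E => E IH.
move=> /destabilizing_semistable_sub[A [Q [i [q [d ssA ltEA ltQE]]]]].
(* Here [D < B <= Q < E < A], so [A] has only trivial morphisms to [D]. *)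
have minE B : le B Q -> minimal_quotient Q B -> minimal_quotient E B.
  move=> leBQ minQ D ssD ltDB; apply: hom_eq_extension d _ (minQ D ssD ltDB).
  apply: hom_semistable => //.
  exact: lt_trans (lt_le_trans ltDB leBQ) (lt_trans ltQE ltEA).
have [ssQ | nssQ] := classic (semistable Q).
  exists A, Q, i, q; split=> //; apply: minE => [|D ssD ltDQ].
    exact: (preord_refl _ _ (stability_preorder le_stability)).
  exact: hom_semistable.
have [Q' [B [j [p [dQ ssB ltBQ minQ]]]]] := IH _ _ _ _ d ltQE nssQ.
have [E' [[i' d'] _]] := exact_quot Delta_exact d dQ.
exists E', B, i', (p \oc q); split=> //; first exact: lt_trans ltQE.
by apply: minE => //; case: ltBQ.
Qed.

(** Were [F] not semistable, a semistable quotient of [F] strictly below it would also be a quotient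
    of [E], strictly below [B], whose projection is not in [S]. *)
Lemma minimal_quotient_le (E B K F : C) (i : Hom K E) (p : Hom E F) :
  minimal_quotient E B -> Delta i p -> le F B -> semistable F /\ ~ lt F B.
Proof.
move=> minE d leFB.
have ssF : semistable F.
  apply: NNPP => /minimal_semistable_quotient[F' [D [j [q [dF ssD ltDF _]]]]].
  have [K' [[i' d'] _]] := exact_quot Delta_exact d dF.
  exact: (Delta_nzr d') (minE D ssD (lt_le_trans ltDF leFB) _).
by split=> // ltFB; apply: (Delta_nzr d); apply: minE.
Qed.

Lemma HN_exists (E : C) :
  exists x : filtration E, Harder_Narasimhan (@Delta) le x.
Proof.
elim/Artinian_ind: E => E IH.
have [ssE | ] := classic (semistable E); first by exists (FiltBase E).
move=> /minimal_semistable_quotient[E' [B [i [p [d ssB ltBE minE]]]]].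
have ltEE' := lt_quotient_sub d ltBE.
have [x hnx] := IH _ _ _ _ d ltEE'.
case: x i d ltEE' hnx => [E0 | K E0 G k g x] i d ltEE' hnx.
  by exists (FiltStep i p (FiltBase E0)); split=> //=; apply: lt_trans ltEE'.
have [hnK dK ssG ltG] := hnx.
have [F [[q dF] [j [r dG]]]] := exact_sub Delta_exact dK d.
(* The seesaw is applied to [G -> F -> B], where [F] is the quotient of [E] by [K]. Minimality of
   [B] excludes [F < B], and makes [F] semistable when the three are equivalent. *)
have [[_ _ ltFB] | [_ ltBG _] | [GF _ FB]] := stability_seesaw le_stability dG.
- by have [_ []] := minimal_quotient_le minE dF ltFB.1.
- by exists (FiltStep i p (FiltStep k g x)).
- exists (FiltStep (i \oc k) q x); split=> //.
    by have [] := minimal_quotient_le minE dF FB.1.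
  exact: le_lt_trans GF.2 ltG.
Qed.

End Existence.

(** * Uniqueness up to isomorphism, for a total preorder *)

Section Uniqueness.

Hypothesis comparable : comparable_objects le.

Lemma not_lt (A B : C) : ~ lt A B -> le B A.
Proof.
move=> nlt; have [AB | //] := comparable A B.
by apply: NNPP => nBA; apply: nlt.
Qed.

(** This excludes different lengths. If [F < A], then [p \oc f] is trivial, hence so is [p];
    otherwise [A] is strictly below all factors of [x], so [g \oc i] is trivial, hence so is [i]. *)
Lemma semistable_iso_HN_step (E A E' F : C) (i : Hom E' E) (p : Hom E F)
    (x : filtration E') (f : Hom A E) (g : Hom E A) :
  f \oc g = idm E -> semistable A ->
  ~ Harder_Narasimhan (@Delta) le (FiltStep i p x).
Proof.
move=> fg ssA [hnx d ssF ltF].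
have leAF : le A F.
  apply: not_lt => ltFA; apply: (Delta_nzr d).
  rewrite -(compm_idr p) -fg compm_assoc; apply: S_compr.
  exact: hom_semistable ltFA _.
apply: (Delta_nzl d); rewrite -(compm_idl i) -fg -compm_assoc.
by apply: S_compl; apply: hom_eq_HN hnx ssA (le_lt_trans leAF ltF) _.
Qed.

Lemma last_factor_le (E1 E2 E' F : C) (i : Hom E' E1) (p : Hom E1 F)
    (x : filtration E2) (f : Hom E1 E2) (g : Hom E2 E1) :
  g \oc f = idm E1 -> Delta i p -> semistable F ->
  Harder_Narasimhan (@Delta) le x -> le (last_factor x) F.
Proof.
move=> gf d ssF hnx; apply: not_lt => ltF; apply: (Delta_nzr d).
rewrite -(compm_idr p) -gf compm_assoc; apply: S_compr.
exact: hom_eq_HN hnx ssF ltF _.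
Qed.

(** An arbitrary isomorphism [f] replaces the identity because the induction hypothesis is applied
    to the map that [f] induces on the preceding terms. *)
Lemma HN_unique (E1 E2 : C) (x : filtration E1) (y : filtration E2)
    (f : Hom E1 E2) :
  Harder_Narasimhan (@Delta) le x -> Harder_Narasimhan (@Delta) le y ->
  is_iso f -> filtration_iso f x y.
Proof.
elim: x E2 y f => [E1' | E1' {}E1 F1 i1 p1 x IHx] _ [E2 | E2' E2 F2 i2 p2 y] f
  hnx hny [g [gf fg]].
- by apply: FiltIsoBase; exists g.
- by case: (semistable_iso_HN_step fg hnx hny).
- by case: (semistable_iso_HN_step gf hny hnx).
have [hnx' d1 ssF1 ltF1] := hnx; have [hny' d2 ssF2 ltF2] := hny.
have leF12 : le F1 F2 := last_factor_le fg d2 ssF2 hnx.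
have leF21 : le F2 F1 := last_factor_le gf d1 ssF1 hny.
have s12 : S (p2 \oc f \oc i1).
  exact: hom_eq_HN hnx' ssF2 (le_lt_trans leF21 ltF1) _.
have s21 : S (p1 \oc g \oc i2).
  exact: hom_eq_HN hny' ssF1 (le_lt_trans leF12 ltF2) _.
have [u pu] := factor_through_quotient d1 s12.
have [v pv] := factor_through_quotient d2 s21.
rewrite -compm_assoc in s12; rewrite -compm_assoc in s21.
have [a ia] := factor_through_sub d2 s12.
have [b ib] := factor_through_sub d1 s21.
(* The pair, with the identity in the middle, is an endomorphism of the sequence [i1], [p1]. *)
have [ba vu] : b \oc a = idm E1' /\ v \oc u = idm F1.
  apply: (exact_identity Delta_exact d1).
    by rewrite compm_assoc ib -compm_assoc ia compm_assoc gf.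
  by rewrite -compm_assoc pu compm_assoc pv -compm_assoc gf.
have [ab uv] : a \oc b = idm E2' /\ u \oc v = idm F2.
  apply: (exact_identity Delta_exact d2).
    by rewrite compm_assoc ia -compm_assoc ib compm_assoc fg.
  by rewrite -compm_assoc pv compm_assoc pu -compm_assoc fg.
apply: (@FiltIsoStep _ _ _ _ _ _ _ _ _ _ _ _ _ a f u) => //.
- by apply: IHx => //; exists b.
- by exists g.
- by exists v.
Qed.

End Uniqueness.

End HarderNarasimhan.

Unset Implicit Arguments.

Theorem theorem1p2
    (C : category) (S : morphism_class C) (Delta : sequence_class C)
    (le : relation C)
    (Delta_exact : exact_class S Delta)
    (Delta_unique : sequences_unique Delta)
    (le_stability : stability_structure Delta le)
    (S_zero : zero_class S)
    (hom_semistable : forall A B : C,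
       semistable Delta le A -> semistable Delta le B ->
       strictly_below le B A -> hom_eq S A B)
    (artinian : weakly_Artinian Delta le)
    (noetherian : weakly_Noetherian Delta le)
    (E : C) :
  (exists x : filtration E, Harder_Narasimhan Delta le x) /\
  (comparable_objects le ->
   forall x y : filtration E,
     Harder_Narasimhan Delta le x -> Harder_Narasimhan Delta le y ->
     filtration_iso (idm E) x y).
Proof.
split=> [|cmp x y hnx hny]; first exact: (HN_exists Delta_exact le_stability).
apply: (HN_unique Delta_exact le_stability S_zero hom_semistable cmp hnx hny).
by exists (idm E); rewrite compm_idl.
Qed.
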